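(* Let $(G,P)$ be a quasi-lattice ordered group with Nica spectrum $\Omega$. The boundary spectrum $\Omega_{\mathcal F}$ is the unique smallest nonempty closed invariant subset of $\Omega$, and it is equal to the closure $\partial\Omega$ of the set of maximal directed subsets of $G$ containing the identity.
   Context: Groups are countable. A quasi-lattice ordered group $(G,P)$ is a group $G$ with a submonoid $P$ with $P\cap P^{-1}=\{e\}$ such that, for the left-invariant partial order $x\le y\iff x^{-1}y\in P$, every two elements of $G$ having a common upper bound have a least upper bound $x\vee y$; write $x\vee y=\infty$ if there is no common upper bound. A subset $\omega\subset G$ is hereditary if $\omega P^{-1}\subset\omega$ and directed if $x\vee y\neq\infty$ and $x\vee y\in\omega$ for all $x,y\in\omega$. (A maximal directed subset is automatically hereditary.) The Nica spectrum $\Omega$ is the set of directed hereditary subsets of $G$ containing $e$, with the topology inherited from $\{0,1\}^G$; it is compact Hausdorff. $G$ acts partially on $\Omega$ by $\theta_t:U_{t^{-1}}\to U_t$, $\omega\mapsto t\omega$, where $U_t=\{\omega\in\Omega:t\in\omega\}$. A subset $X\subset\Omega$ is invariant if $\theta_t(X\cap U_{t^{-1}})\subset X$ for all $t\in G$. Let $\mathcal Q$ be the collection of all finite subsets of $P$ (including $\emptyset$). For $\mathcal R\subset\mathcal Q$ put $\Omega_{\mathcal R}=\{\omega\in\Omega:\omega\cap tH\neq\emptyset\text{ for all }t\in\omega\text{ and }H\in\mathcal R\}$. Define $\mathcal F=\{F\in\mathcal Q:\text{for all }z\in P\text{ there exists }x\in F\text{ with }x\vee z\neq\infty\}$; the boundary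 spectrum is $\Omega_{\mathcal F}$. *)

(* Defs.v *)
From mathcomp Require Import all_boot all_classical topology.
Set Implicit Arguments.
Unset Strict Implicit.
Unset Printing Implicit Defensive.
Local Open Scope classical_set_scope.
Local Open Scope group_scope.

Section QuasiLatticeOrder.
Context {G : groupType} (P : set G).
Implicit Types (x y z t : G) (A B F H : set G).

Definition preceq x y : Prop := P (x^-1 * y).

Definition common_ub x y z : Prop := preceq x z /\ preceq y z.

(* [is_join x y z] says that x \/ y exists and equals z. *)
Definition is_join x y z : Prop :=
  common_ub x y z /\ forall u, common_ub x y u -> preceq z u.

(* x \/ y <> oo, since x \/ y = oo means that x and y have no common upper
   bound. *)
Definition compatible x y : Prop := exists z, common_ub x y z.

Record quasi_lattice_ordered : Prop := QuasiLatticeOrdered {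
  qlo_one : P 1 ;
  qlo_mul : forall x y, P x -> P y -> P (x * y) ;
  qlo_pointed : P `&` [set x^-1 | x in P] = [set 1] ;
  qlo_join : forall x y, compatible x y -> exists z, is_join x y z
}.

Definition hereditary A : Prop := [set x * p^-1 | x in A & p in P] `<=` A.

Definition directed A : Prop :=
  forall x y, A x -> A y -> compatible x y /\ exists2 z, is_join x y z & A z.

Definition maximal_directed A : Prop :=
  directed A /\ forall B, directed B -> A `<=` B -> B = A.

(* The points of {0,1}^G are characteristic functions w : G -> bool, with the
   product topology; [set x | w x] is the subset of G with characteristic
   function w. *)
Definition subset_space : topologicalType := {ptws G -> bool}.

Definition Nica_spectrum : set subset_space :=
  [set w : subset_space |
     [/\ directed [set x | w x], hereditary [set x | w x] & w 1]].

Definition U_ t : set subset_space :=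
  Nica_spectrum `&` [set w : subset_space | w t].

(* The characteristic function of t w. The partial homeomorphism theta_t is the
   restriction of this map to U_ t^-1. *)
Definition theta t (w : subset_space) : subset_space := fun x => w (t^-1 * x).

Definition theta_invariant (X : set subset_space) : Prop :=
  forall t, theta t @` (X `&` U_ t^-1) `<=` X.

Definition finite_parts : set (set G) := [set F | finite_set F /\ F `<=` P].

Definition Omega (R : set (set G)) : set subset_space :=
  Nica_spectrum `&`
  [set w : subset_space | forall t H, w t -> R H ->
     [set x | w x] `&` [set t * h | h in H] !=set0].

Definition boundary_relations : set (set G) :=
  finite_parts `&`
  [set F | forall z, P z -> exists2 x, F x & compatible x z].

Definition boundary_spectrum : set subset_space := Omega boundary_relations.

(* [subspace Nica_spectrum] carries the topology inherited from {0,1}^G on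
   Nica_spectrum; the points outside Nica_spectrum are isolated and play no
   role for X `<=` Nica_spectrum. *)
Definition nonempty_closed_invariant (X : set subset_space) : Prop :=
  [/\ X `<=` Nica_spectrum, X !=set0,
      closed (X : set (subspace Nica_spectrum)) & theta_invariant X].

Definition smallest_nonempty_closed_invariant (X : set subset_space) : Prop :=
  nonempty_closed_invariant X /\
  forall Y, nonempty_closed_invariant Y -> X `<=` Y.

Definition maximal_points : set subset_space :=
  [set w : subset_space | maximal_directed [set x | w x] /\ w 1].

Definition boundary : set subset_space :=
  closure (maximal_points : set (subspace Nica_spectrum)).

End QuasiLatticeOrder.

(* Main.v *)
(** Given [w] in the boundary spectrum and a finite set of coordinates, let [u]
    in [w] be an upper bound of 1 and of the coordinates lying in [w]. Each
    coordinate [b] outside [w] that is compatible with [u] has a join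
    [b \/ u = u p_b], and [u p_b] is not in [w]. The finite set [{p_b}] thus
    fails to meet [u^-1 w], so it is not a boundary relation: some [z] in [P]
    is incompatible with every [p_b]. Hence any directed hereditary set
    containing [u z] agrees with [w] on the given coordinates. Since the
    translate by [u z] of any point of the spectrum contains [u z], every
    nonempty invariant subset accumulates at [w]. Applied to the set of maximal
    points, this also gives density of the latter in the boundary spectrum. *)

Require Import Defs.
From mathcomp Require Import all_boot all_classical topology.
Set Implicit Arguments.
Unset Strict Implicit.
Unset Printing Implicit Defensive.
Local Open Scope classical_set_scope.
Local Open Scope group_scope.

(** * Neighbourhoods and closures in {0,1}^G by cylinder sets *)

Section CylinderTopology.
Context {G : groupType}.

Lemma nbhs_cylinder (w : @subset_space G) (s : seq G) :
  nbhs w [set v : @subset_space G | {in s, v =1 w}].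
Proof.
elim: s => [|a s IHs]; first by apply: filterS filterT => v _ x.
have nbhs_a : nbhs w [set v : @subset_space G | v a = w a].
  apply: (@proj_continuous G (fun=> bool) a w [set w a]).
  exact: discrete_set1.
apply: filterS (filterI nbhs_a IHs) => v [/= va vs] x.
by rewrite inE => /orP[/eqP-> //|]; apply: vs.
Qed.

(** The sets containing a cylinder around [w] form a filter. The product topology is the supremum of
    the topologies induced by the projections, so it suffices that this filter converges to [w] in
    each of them, where a single coordinate decides. *)
Lemma cylinder_nbhs (w : @subset_space G) (B : set (@subset_space G)) :
  nbhs w B ->
  exists s : seq G, [set v : @subset_space G | {in s, v =1 w}] `<=` B.
Proof.
pose F : set_system (@subset_space G) := [set C | exists s : seq G,
  [set v : @subset_space G | {in s, v =1 w}] `<=` C].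
have FF : Filter F.
  split; first by exists [::].
    move=> C D [s sC] [t tD]; exists (s ++ t) => v vst; split.
      by apply: sC => x xs; apply: vst; rewrite mem_cat xs.
    by apply: tD => x xt; apply: vst; rewrite mem_cat xt orbT.
  by move=> C D CD [s sC]; exists s; apply: subset_trans CD.
suff: F --> w by apply.
apply/cvg_sup => t C [D [[E oE <-] Ewt] EC].
exists [:: t] => v /= vw; apply: EC; move: Ewt.
by rewrite /proj /= vw ?mem_head.
Qed.

Lemma closure_subspaceP (A X : set (@subset_space G)) (w : @subset_space G) :
  A w -> X `<=` A ->
  closure (X : set (subspace A)) w <->
  forall s : seq G, exists2 v, X v & {in s, v =1 w}.
Proof.
move=> Aw XA; split=> [clX s|cylX B].
  have [|v [Xv /= vw]] := clX [set v : @subset_space G | A v -> {in s, v =1 w}].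
    change (@nbhs_subspace _ A w [set v | A v -> {in s, v =1 w}]).
    rewrite -nbhs_subspace_in //.
    by apply: (@filterS _ (nbhs w) _ _ _ _ (nbhs_cylinder w s)) => v vw _ _.
  by exists v => //; apply: vw; apply: XA.
change (@nbhs_subspace _ A w B -> X `&` B !=set0).
rewrite -nbhs_subspace_in // => /cylinder_nbhs[s sB].
by have [v Xv vw] := cylX s; exists v; split=> //; apply: sB => //; apply: XA.
Qed.

(** A point outside [A] is isolated in [subspace A], so it is no limit of points of [X]. *)
Lemma closure_subspace_sub (A X : set (@subset_space G)) :
  X `<=` A -> closure (X : set (subspace A)) `<=` A.
Proof.
move=> XA w clX; apply: contrapT => nAw.
have [|v [Xv /= vw]] := clX [set w].
  change (@nbhs_subspace _ A w [set w]).
  by rewrite -nbhs_subspace_out // => v.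
by apply: nAw; rewrite -vw; apply: XA.
Qed.

End CylinderTopology.

Section NicaSpectrum.
Context {G : groupType} {P : set G} (hP : quasi_lattice_ordered P).
Implicit Types (x y z t : G) (A B : set G).

Local Notation "x <<= y" := (preceq P x y) (at level 70).

(** * The left-invariant order *)

Lemma preceq_refl x : x <<= x.
Proof. by rewrite /preceq mulVg; apply: qlo_one hP. Qed.

Lemma preceq_trans y x z : x <<= y -> y <<= z -> x <<= z.
Proof.
move=> xy yz; have := qlo_mul hP xy yz.
by rewrite -mulgA mulVKg.
Qed.

Lemma preceq_mul2l t x y : t * x <<= t * y <-> x <<= y.
Proof. by rewrite /preceq invgM -mulgA mulKg. Qed.

Lemma preceq_mulr x y : P y -> x <<= x * y.
Proof. by rewrite /preceq mulKg. Qed.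

Lemma preceq1 x : 1 <<= x <-> P x.
Proof. by rewrite /preceq invg1 mul1g. Qed.

Lemma compatible_mul2l t x y :
  compatible P (t * x) (t * y) <-> compatible P x y.
Proof.
split=> -[u [xu yu]]; last by exists (t * u); split; apply/preceq_mul2l.
by exists (t^-1 * u); split; apply/(preceq_mul2l t); rewrite mulVKg.
Qed.

Lemma is_join_mul2l t x y z :
  is_join P x y z -> is_join P (t * x) (t * y) (t * z).
Proof.
move=> [[xz yz] zmin]; split=> [|u [xu yu]]; first by split; apply/preceq_mul2l.
rewrite -(mulVKg t u); apply/preceq_mul2l/zmin.
by split; apply/(preceq_mul2l t); rewrite mulVKg.
Qed.

(** * Hereditary and directed sets *)

Lemma hereditaryP A :
  hereditary P A <-> forall x y, A y -> x <<= y -> A x.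
Proof.
split=> [hA x y Ay xy|hA _ [y Ay [p Pp <-]]].
  by apply: hA; exists y => //; exists (x^-1 * y) => //; rewrite invgM invgK mulVKg.
by apply: hA Ay _; rewrite /preceq invgM invgK mulgVK.
Qed.

(** A join lies below every common upper bound, hence below an element of [A]. Only upper bounds in
    [A] are asked for, so that [A] may also be a set of joins. *)
Lemma directed_down_closure A :
  (forall x y, A x -> A y -> exists2 u, A u & common_ub P x y u) ->
  directed P [set z | exists2 u, A u & z <<= u].
Proof.
move=> ubA x y [a Aa xa] [b Ab yb].
have [u Au [au bu]] := ubA _ _ Aa Ab.
have xyu : common_ub P x y u.
  by split; [apply: preceq_trans au | apply: preceq_trans bu].
have cxy : compatible P x y by exists u.
split=> //; have [z jz] := qlo_join hP cxy.
by exists z => //; exists u => //; apply: (proj2 jz).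
Qed.

Lemma directed_ub A x y :
  directed P A -> A x -> A y -> exists2 u, A u & common_ub P x y u.
Proof. by move=> dA Ax Ay; have [_ [u [ub _] Au]] := dA _ _ Ax Ay; exists u. Qed.

Lemma directed_seq_ub A a (s : seq G) :
  directed P A -> A a ->
  exists u, [/\ A u, a <<= u & forall x, x \in s -> A x -> x <<= u].
Proof.
move=> dA Aa; elim: s => [|b s [u [Au au su]]].
  by exists a; split=> //; apply: preceq_refl.
have [Ab|nAb] := pselect (A b); last first.
  by exists u; split=> // x; rewrite inE => /orP[/eqP->|]; last apply: su.
have [v Av [uv bv]] := directed_ub dA Au Ab.
exists v; split=> //; first exact: preceq_trans uv.
move=> x; rewrite inE => /orP[/eqP-> //|xs Ax].
by apply: preceq_trans uv; apply: su.
Qed.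

(** * Translation of subsets *)

Definition translate t A : set G := [set x | A (t^-1 * x)].

Lemma translateK t A : translate t (translate t^-1 A) = A.
Proof. by apply/funext => x; rewrite /translate /= invgK mulVKg. Qed.

Lemma translateVK t A : translate t^-1 (translate t A) = A.
Proof. by apply/funext => x; rewrite /translate /= invgK mulKg. Qed.

Lemma directed_translate t A : directed P A -> directed P (translate t A).
Proof.
move=> dA x y Ax Ay; have [cxy [z jz Az]] := dA _ _ Ax Ay.
split; first by move: cxy => /compatible_mul2l.
exists (t * z); last by rewrite /translate /= mulKg.
by rewrite -(mulVKg t x) -(mulVKg t y); apply: is_join_mul2l.
Qed.

Lemma hereditary_translate t A : hereditary P A -> hereditary P (translate t A).
Proof.
move=> /hereditaryP hA; apply/hereditaryP => x y Ay xy.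
by apply: hA Ay _; apply/preceq_mul2l.
Qed.

Lemma maximal_directed_translate t A :
  maximal_directed P A -> maximal_directed P (translate t A).
Proof.
move=> [dA mA]; split=> [|B dB AB]; first exact: directed_translate.
rewrite -(translateK t B); congr (translate t _).
apply: mA; first exact: directed_translate.
by rewrite -[X in X `<=` _](translateVK t) => x; apply: AB.
Qed.

(** * Maximal directed sets *)

Lemma maximal_directed_hereditary A : maximal_directed P A -> hereditary P A.
Proof.
move=> [dA mA]; apply/hereditaryP => x y Ay xy.
(* The down-closure of [A] is directed and contains [A], so by maximality it equals [A]. *)
rewrite -(mA [set z | exists2 u, A u & z <<= u]).
- by exists y.
- by apply: directed_down_closure => a b; apply: directed_ub.
- by move=> a Aa; exists a => //; apply: preceq_refl.
Qed.

(* The elements below some [x \/ y] with [y] in [A] form a directed set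
   containing [A] and [x]. *)
Lemma maximal_directed_mem A x :
  maximal_directed P A -> A !=set0 -> (forall y, A y -> compatible P x y) ->
  A x.
Proof.
move=> [dA mA] [a Aa] cA.
pose J := [set j | exists2 y, A y & is_join P x y j].
have memJ y : A y -> exists2 j, J j & common_ub P x y j.
  by move=> Ay; have [j jj] := qlo_join hP (cA y Ay); exists j; [exists y|case: jj].
rewrite -(mA [set z | exists2 u, J u & z <<= u]).
- by have [j Jj [xj _]] := memJ a Aa; exists j.
- apply: directed_down_closure => j k [y Ay jy] [z Az kz].
  have [u Au [yu zu]] := directed_ub dA Ay Az.
  have [l Jl [xl ul]] := memJ u Au; exists l => //; split.
    by apply: (proj2 jy); split=> //; apply: preceq_trans ul.
  by apply: (proj2 kz); split=> //; apply: preceq_trans ul.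
- by move=> y Ay; have [j Jj [_ yj]] := memJ y Ay; exists j.
Qed.

Lemma maximal_points_Nica : maximal_points P `<=` Nica_spectrum P.
Proof.
by move=> w [mw w1]; split=> //; [case: mw | apply: maximal_directed_hereditary].
Qed.

(** Zorn's lemma applies to directed sets under inclusion: two elements of the union of a chain
    already lie in one member. The maximal set obtained may miss 1, so it is translated by the
    inverse of one of its elements. *)
Lemma maximal_points_nonempty : maximal_points P !=set0.
Proof.
have [F FdP Ftot|A [dA mA]] := @Zorn_bigcup G (directed P).
  move=> x y [A FA Ax] [B FB By].
  have [AB|BA] := Ftot _ _ FA FB.
    by have [c [z jz Bz]] := FdP _ FB _ _ (AB _ Ax) By; split=> //; exists z => //; exists B.
  by have [c [z jz Az]] := FdP _ FA _ _ Ax (BA _ By); split=> //; exists z => //; exists A.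
have {}mA : maximal_directed P A.
  split=> // B dB AB; apply: contrapT => BA; apply: (mA B) => //.
  by split=> // BA'; apply: BA; apply/seteqP.
(* The empty set is directed too, but it is not maximal, being contained in {1}. *)
have [a Aa] : A !=set0.
  apply/set0P/eqP => A0; have d1 : directed P [set 1].
    move=> _ _ -> ->; split; first by exists 1; split; apply: preceq_refl.
    by exists 1 => //; split=> [|u []//]; split; apply: preceq_refl.
  by have := proj2 mA _ d1; rewrite A0 => /(_ (@sub0set _ _)) /seteqP[/(_ 1 erefl)].
exists (fun x => `[< translate a^-1 A x >]); split.
  have -> : [set x | `[< translate a^-1 A x >]] = translate a^-1 A.
    by apply/funext => x /=; rewrite asboolE.
  exact: maximal_directed_translate.
by apply/asboolP; rewrite /translate /= invgK mulg1.
Qed.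

Lemma Nica_theta {t} {w : @subset_space G} :
  Nica_spectrum P w -> w t^-1 -> Nica_spectrum P (theta t w).
Proof.
move=> [dw hw _] wt; split; last by rewrite /theta mulg1.
- exact: (directed_translate (t := t) dw).
- exact: (hereditary_translate (t := t) hw).
Qed.

Lemma maximal_points_invariant : theta_invariant P (maximal_points P).
Proof.
move=> t _ [w [[mw w1] [_ wt]] <-]; split; last by rewrite /theta mulg1.
exact: (maximal_directed_translate t mw).
Qed.

(* If no element of [t F] lies in the maximal set [w], each [f] in [F] is
   incompatible with some element of [t^-1 w]; an upper bound of these
   elements and 1 contradicts the definition of a boundary relation. *)
Lemma maximal_points_boundary_spectrum :
  maximal_points P `<=` boundary_spectrum P.
Proof.
move=> w mw; split; first exact: maximal_points_Nica.
move=> t F wt [[/finite_seqP[s Fs] _] FP].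
have mA := maximal_directed_translate t^-1 (proj1 mw).
set A := translate t^-1 _ in mA.
have A1 : A 1 by rewrite /A /translate /= invgK mulg1.
apply: contrapT => wtF.
have nA f : exists y, F f -> A y /\ ~ compatible P f y.
  have [Ff|nFf] := pselect (F f); last by exists 1.
  apply: contrapT => cf; apply: wtF.
  exists (t * f); split; last by exists f.
  suff: A f by rewrite /A /translate /= invgK.
  apply: maximal_directed_mem => //; first by exists 1.
  by move=> y Ay; apply: contrapT => nc; apply: cf; exists y.
have [y yP] := choice nA.
have [u [Au u1 uy]] := directed_seq_ub (map y s) (proj1 mA) A1.
have [f Ff [v [fv uv]]] := FP u (proj1 (preceq1 u) u1).
have [Ay] := yP f Ff; apply; exists v; split=> //.
apply: preceq_trans uv; apply: uy => //; apply: map_f.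
by move: Ff; rewrite Fs.
Qed.

(** * Accumulation of invariant sets at boundary points *)

Lemma boundary_spectrum_sep (w : @subset_space G) (s : seq G) :
  boundary_spectrum P w ->
  exists2 a, P a & forall v, Nica_spectrum P v -> v a -> {in s, v =1 w}.
Proof.
move=> [[dw hw w1] wR].
(* Bounding 1 as well puts [u] in [P], and later [u * z] too. *)
have [u [wu u1 us]] := directed_seq_ub s dw w1.
move/preceq1: u1 => Pu.
have [f fP] : exists f : G -> G,
    forall b, compatible P b u -> is_join P b u (f b).
  have jb b : exists z, compatible P b u -> is_join P b u z.
    have [/(qlo_join hP)[z jz]|nc] := pselect (compatible P b u).
      by exists z.
    (* A default value where there is no join. *)
    by exists 1.
  by have [f fP] := choice jb; exists f.
pose B := [set b | [/\ b \in s, ~ w b & compatible P b u]].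
pose F := [set u^-1 * f b | b in B].
have Ffin : finite_parts P F.
  split; last by move=> _ [b [_ _ /fP [[_ ?] _]] <-].
  apply: finite_image; apply: sub_finite_set (finite_seq s).
  by move=> b [].
have nF : ~ boundary_relations P F.
  (* Otherwise [w] would contain some [f b], and by heredity also [b], which lies below it. *)
  move=> FR; have [_ [/[swap] -[_ [b [_ nwb /fP[[bf _] _]] <-] <-] /= wb]] := wR _ _ wu FR.
  apply: nwb; move/hereditaryP: hw => hw; apply: hw bf.
  by rewrite mulVKg in wb.
have [z Pz zF] : exists2 z, P z & forall x, F x -> ~ compatible P x z.
  apply: contrapT => nz; apply: nF; split=> // z Pz.
  apply: contrapT => nx; apply: nz; exists z => // x Fx cx.
  by apply: nx; exists x.
exists (u * z); first exact: (qlo_mul hP).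
move=> v [dv hv v1] vuz x xs.
have uuz : u <<= u * z by apply: preceq_mulr.
have [wx|nwx] := pselect (w x).
  rewrite wx; move/hereditaryP: hv; apply; first exact: vuz.
  by apply: preceq_trans uuz; apply: us.
move/negP/negbTE: (nwx) => ->; apply/negbTE/negP => vx.
have [y _ [xy uzy]] := directed_ub dv vx vuz.
have uy := preceq_trans uuz uzy.
have cxu : compatible P x u by exists y.
(* As [y] bounds [x], [u] and [u * z], it bounds the join [f x]; hence [u^-1 * y] bounds both
   [u^-1 * f x] and [z], against the choice of [z]. *)
apply: (zF (u^-1 * f x)); first by exists x.
exists (u^-1 * y); split; last by apply/(preceq_mul2l u); rewrite mulVKg.
by apply/preceq_mul2l; apply: (proj2 (fP x cxu)).
Qed.

Lemma boundary_spectrum_sub_closure (X : set (@subset_space G)) :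
  X `<=` Nica_spectrum P -> X !=set0 -> theta_invariant P X ->
  boundary_spectrum P `<=` closure (X : set (subspace (Nica_spectrum P))).
Proof.
move=> XN [v Xv] Xinv w Bw; apply/closure_subspaceP => //; first by case: Bw.
move=> s; have [a Pa aP] := boundary_spectrum_sep s Bw.
have [_ hv v1] := XN _ Xv.
(* Since [a] is in [P], [a^-1] lies below 1, so the partial action by [a] is defined at [v]. *)
have va : v a^-1.
  by move/hereditaryP: hv; apply; first exact: v1; rewrite /preceq invgK mulg1.
have Xav : X (theta a v).
  by apply: Xinv; exists v => //; split=> //; split=> //; apply: XN.
exists (theta a v) => //; apply: aP; first exact: XN.
by rewrite /theta mulVg.
Qed.

(** * Closedness and invariance of the boundary spectrum *)

Lemma boundary_spectrum_Nica : boundary_spectrum P `<=` Nica_spectrum P.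
Proof. exact: subIsetl. Qed.

(** For fixed [t] and [F] the defining condition involves only the coordinate [t] and the finitely
    many [t * h] with [h] in [F], so it passes to limits. *)
Lemma closed_boundary_spectrum :
  closed (boundary_spectrum P : set (subspace (Nica_spectrum P))).
Proof.
move=> w clw.
have Nw := closure_subspace_sub boundary_spectrum_Nica clw.
split=> // t F wt FR.
have [[/finite_seqP[s Fs] _] _] := FR.
have cyl := proj1 (closure_subspaceP Nw boundary_spectrum_Nica) clw.
have [v [_ vR] vw] := cyl (t :: [seq t * h | h <- s]).
have vt : v t by rewrite vw ?mem_head.
have [_ [/[swap] -[h Fh <-] /= vh]] := vR _ _ vt FR.
exists (t * h); split; last by exists h.
rewrite /= -vw // inE map_f ?orbT //.
by move: Fh; rewrite Fs.
Qed.

Lemma boundary_spectrum_invariant : theta_invariant P (boundary_spectrum P).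
Proof.
move=> t _ [w [[Nw wR] [_ wt]] <-]; split; first exact: Nica_theta.
move=> r F wr FR; have [_ [/[swap] -[h Fh <-] /= wh]] := wR _ _ wr FR.
exists (r * h); split; last by exists h.
by rewrite /= /theta mulgA.
Qed.

End NicaSpectrum.

Theorem lemma3p5 (G : groupType) (P : set G)
    (hG : countable [set: G]) (hP : quasi_lattice_ordered P) :
  [/\ smallest_nonempty_closed_invariant P (boundary_spectrum P),
      (forall X : set subset_space,
         smallest_nonempty_closed_invariant P X -> X = boundary_spectrum P) &
      boundary_spectrum P = boundary P].
Proof.
have smallest :
    smallest_nonempty_closed_invariant P (boundary_spectrum P).
  split.
    split; first exact: boundary_spectrum_Nica.
    - have [w mw] := maximal_points_nonempty hP.
      by exists w; apply: maximal_points_boundary_spectrum.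
    - exact: closed_boundary_spectrum.
    - exact: boundary_spectrum_invariant.
  move=> Y [YN Y0 Ycl Yinv] w Bw; apply: Ycl.
  exact: boundary_spectrum_sub_closure.
split=> //.
  move=> X [Xnci Xmin]; apply/seteqP; split.
    by apply: Xmin; case: smallest.
  by case: smallest => _; apply.
apply/seteqP; split.
  apply: boundary_spectrum_sub_closure => //.
  - exact: maximal_points_Nica.
  - exact: maximal_points_nonempty.
  - exact: maximal_points_invariant.
(* Maximal points lie in the boundary spectrum, which is closed and so contains their closure. *)
move=> w clw; apply: closed_boundary_spectrum.
apply: (@closureS (subspace (Nica_spectrum P)) _ _ _ _ clw).
exact: maximal_points_boundary_spectrum.
Qed.
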